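(* Let $f:\mathbb{R}^n\to\mathbb{R}$ be a CN function with CN form $f=[g:g_1,\dots,g_r]$, and let $(\bm x^*,\bm y^* )\in X(f)$. Consider the problem $$(\mathrm{LCNP})(\bm x^*,\bm y^* ):\quad\min\ \nabla g(\bm x^*,\bm y^* )^\top\bm d\quad\text{s.t. }\bm d\in T(\bm x^*,\bm y^* ).$$ If $\bm d^*$ is an optimal solution to $(\mathrm{LCNP})(\bm x^*,\bm y^* )$ such that $\nabla g(\bm x^*,\bm y^* )^\top\bm d^*\ge0$, then $(\bm x^*,\bm y^* )$ is an optimal solution to (CNP) and $\bm x^*$ is an optimal solution to (CNO). Furthermore, if there is a $\bm d'$ such that $\nabla g_i(\bm x^*,\bm y^* )^\top\bm d'<0$, $i=1,\dots,r$, then there are $\alpha_i^*\ge0$, $i=1,\dots,r$, such that $$\nabla g(\bm x^*,\bm y^* )+\sum_{i=1}^r\alpha_i^*\nabla g_i(\bm x^*,\bm y^* )=0,\qquad\alpha_i^*\nabla g_i(\bm x^*,\bm y^* )^\top\bm d^*=0,\ i=1,\dots,r.\quad(\ast)$$ Conversely, if there are $\bm d^*\in T(\bm x^*,\bm y^* )$ and $\alpha_i^*\ge0$, $i=1,\dots,r$, such that $(\ast)$ holds, then $(\bm x^*,\bm y^* )$ is an optimal solution to (CNP) and $\bm x^*$ is an optimal solution to (CNO).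
   Context: Let $f:\mathbb{R}^n\to\mathbb{R}$ be nonconvex and let $g,g_1,\dots,g_r:\mathbb{R}^n\times\mathbb{R}^m\to\mathbb{R}$ ($r\ge1$) be convex. Put $X(\bm g)=\{(\bm x,\bm y)\in\mathbb{R}^n\times\mathbb{R}^m: g_i(\bm x,\bm y)=0,\ i=1,\dots,r\}$. The function $f$ is a CN (convertible nonconvex) function with CN form $f=[g:g_1,\dots,g_r]$ if for each $\bm x\in\mathbb{R}^n$ there is $\bm y\in\mathbb{R}^m$ with $(\bm x,\bm y)\in X(\bm g)$ and $f(\bm x)=g(\bm x,\bm y)=\min_{(\bm x,\bm y')\in X(\bm g)}g(\bm x,\bm y')$. Put $X(f)=\{(\bm x,\bm y)\in X(\bm g): f(\bm x)=g(\bm x,\bm y)\}$. Standing assumption: $g,g_1,\dots,g_r$ are twice differentiable ($f$ need not be differentiable). (CNO): $\min f(\bm x)$ s.t. $\bm x\in\mathbb{R}^n$. (CNP): $\min g(\bm x,\bm y)$ s.t. $(\bm x,\bm y)\in\mathbb{R}^n\times\mathbb{R}^m$, $g_i(\bm x,\bm y)=0$, $i=1,\dots,r$. ''Optimal solution'' means global minimizer. $T(\bm x,\bm y)=\{\bm d\in\mathbb{R}^n\times\mathbb{R}^m:\nabla g_i(\bm x,\bm y)^\top\bm d\le0,\ i=1,\dots,r\}$. *)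

(* Defs.v *)
From mathcomp Require Import all_boot all_order all_algebra.
From mathcomp Require Import all_classical all_reals all_analysis.
Import Order.TTheory GRing.Theory Num.Theory.
Import numFieldNormedType.Exports.

Set Implicit Arguments.
Unset Strict Implicit.
Unset Printing Implicit Defensive.

Local Open Scope classical_set_scope.
Local Open Scope ring_scope.

(* A point (x, y) of R^n x R^m is the row vector [row_mx x y : 'rV[R]_(n + m)]. *)

Definition dotp (R : realType) (p : nat) (u v : 'rV[R]_p) : R :=
  \sum_(i < p) u 0 i * v 0 i.

Definition gradient (R : realType) (p : nat) (h : 'rV[R]_p -> R)
    (z : 'rV[R]_p) : 'rV[R]_p :=
  \row_(i < p) 'D_(delta_mx 0 i) h z.

(* Frechet differentiability, of [h] and then of its gradient map. *)
Definition twice_differentiable (R : realType) (p : nat)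
    (h : 'rV[R]_p -> R) : Prop :=
  (forall z, differentiable h z) /\ (forall z, differentiable (gradient h) z).

Definition convex_on_space (R : realType) (p : nat)
    (h : 'rV[R]_p -> R) : Prop :=
  convex_function [set: convex_lmodType 'rV[R]_p] h.

Definition optimal_solution (R : realType) (V : Type)
    (D : set V) (F : V -> R) (z : V) : Prop :=
  D z /\ forall w, D w -> F z <= F w.

Section CN.
Variables (R : realType) (n m r : nat).
Implicit Types (f : 'rV[R]_n -> R) (g : 'rV[R]_(n + m) -> R)
  (gs : 'I_r -> 'rV[R]_(n + m) -> R) (z d : 'rV[R]_(n + m)).

Definition Xg gs : set 'rV[R]_(n + m) := [set z | forall i, gs i z = 0].

(* The minimum in the CN form is over y' alone, with x fixed. *)
Definition CN_form f g gs : Prop :=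
  [/\ (0 < r)%N, ~ convex_on_space f, convex_on_space g,
      forall i, convex_on_space (gs i) &
      forall x : 'rV[R]_n, exists y : 'rV[R]_m,
        f x = g (row_mx x y) /\
        optimal_solution [set y' | Xg gs (row_mx x y')]
                         (fun y' => g (row_mx x y')) y].

Definition Xf f g gs : set 'rV[R]_(n + m) :=
  [set z | Xg gs z /\ f (lsubmx z) = g z].

Definition CNO_optimal f (x : 'rV[R]_n) : Prop :=
  optimal_solution [set: 'rV[R]_n] f x.

Definition CNP_optimal g gs z : Prop := optimal_solution (Xg gs) g z.

Definition T gs z : set 'rV[R]_(n + m) :=
  [set d | forall i, dotp (gradient (gs i) z) d <= 0].

Definition LCNP_optimal g gs z d : Prop :=
  optimal_solution (T gs z) (dotp (gradient g z)) d.

Definition KKT g gs z d (a : 'I_r -> R) : Prop :=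
  gradient g z + \sum_(i < r) a i *: gradient (gs i) z = 0 /\
  forall i, a i * dotp (gradient (gs i) z) d = 0.

End CN.

(* Main.v *)
Require Import Defs.
From mathcomp Require Import all_boot all_order all_algebra.
From mathcomp Require Import all_classical all_reals all_analysis.
From mathcomp Require Import lra.
Import Order.TTheory GRing.Theory Num.Theory.
Import numFieldNormedType.Exports.

(** Linearization of convex functions is what makes the theorem true.  A
    differentiable convex [h] lies above its tangent hyperplane at [z]
    ([convex_tangent_le]), so moving from a zero [z] of the constraints
    [gs i] to another zero [w] cannot increase any linearized constraint:
    [w - z] is feasible for the linearized problem.  If the linearized
    objective is nonnegative on all feasible directions, the tangent bound
    for [g] gives [g z <= g w], hence global optimality in (CNP)
    ([linearized_ge0_CNP_optimal]).  Every value of [f] is a value of [g] on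
    the feasible set, so optimality passes to (CNO).

    For multipliers, nonnegativity of the gradient of [g] on the polyhedral
    cone [T gs z] is exactly the hypothesis of Farkas' lemma ([farkas]), which
    writes the negated gradient as a nonnegative combination of the constraint
    gradients.  Since [0] is feasible, an optimal direction with nonnegative
    value has value zero; pairing the stationarity equation with it gives a
    vanishing sum of terms of one sign, which is complementarity.
    Conversely, pairing stationarity with any feasible direction shows that
    the linearized objective is nonnegative there. *)

Local Open Scope classical_set_scope.
Local Open Scope ring_scope.

(** * The standard inner product *)

Section InnerProduct.
Variables (R : realType) (p : nat).
Implicit Types u v w : 'rV[R]_p.

Lemma dotpC u v : dotp u v = dotp v u.
Proof. by apply: eq_bigr => i _; rewrite mulrC. Qed.

Lemma dotpDr u v w : dotp u (v + w) = dotp u v + dotp u w.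
Proof.
by rewrite -big_split; apply: eq_bigr => i _; rewrite mxE mulrDr.
Qed.

Lemma dotpZr c u v : dotp u (c *: v) = c * dotp u v.
Proof. by rewrite mulr_sumr; apply: eq_bigr => i _; rewrite mxE mulrCA. Qed.

Lemma dotpNr u v : dotp u (- v) = - dotp u v.
Proof. by rewrite -scaleN1r dotpZr mulN1r. Qed.

Lemma dotpBr u v w : dotp u (v - w) = dotp u v - dotp u w.
Proof. by rewrite dotpDr dotpNr. Qed.

Lemma dotp0r u : dotp u 0 = 0.
Proof. by rewrite -(scale0r u) dotpZr mul0r. Qed.

Lemma dotpDl u v w : dotp (u + v) w = dotp u w + dotp v w.
Proof. by rewrite dotpC dotpDr !(dotpC w). Qed.

Lemma dotpZl c u v : dotp (c *: u) v = c * dotp u v.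
Proof. by rewrite dotpC dotpZr (dotpC v). Qed.

Lemma dotpBl u v w : dotp (u - v) w = dotp u w - dotp v w.
Proof. by rewrite dotpC dotpBr !(dotpC w). Qed.

Lemma dotpNl u v : dotp (- u) v = - dotp u v.
Proof. by rewrite dotpC dotpNr dotpC. Qed.

Lemma dotp_suml (I : finType) (F : I -> 'rV[R]_p) v :
  dotp (\sum_i F i) v = \sum_i dotp (F i) v.
Proof.
apply: (big_morph (fun u => dotp u v)) => [u w|]; first exact: dotpDl.
by rewrite dotpC dotp0r.
Qed.

Lemma dotp_self_le0 u : dotp u u <= 0 -> u = 0.
Proof.
move=> uu_le0; have uu_ge0 (i : 'I_p) : true -> 0 <= u 0 i * u 0 i.
  by rewrite -expr2 sqr_ge0.
have /eqP uu0 : dotp u u == 0 by rewrite eq_le uu_le0 sumr_ge0.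
apply/rowP => i; rewrite mxE; apply/eqP.
by have /eqP := psumr_eq0P uu_ge0 uu0 (isT : xpredT i); rewrite mulf_eq0 orbb.
Qed.

End InnerProduct.

(** * Farkas' lemma *)

(** Bartl's induction on the number of constraints, which avoids proving that
    a finitely generated cone is closed and separating from it.
    If the constraints without [a ord0] already imply the conclusion, give
    [a ord0] the coefficient zero.  Otherwise some [x] violates the conclusion
    while satisfying those constraints; it must violate [a ord0], so it can be
    scaled to have [dotp (a ord0) x = 1].  Projecting along [x] onto the
    hyperplane orthogonal to [a ord0] makes that constraint trivial, and the
    induction hypothesis applies to the functionals composed with this
    projection.  Undoing the projection leaves [a ord0] with a coefficient
    that is nonnegative by the choice of [x]. *)
Lemma farkas (R : realType) (p r : nat) (a : 'I_r -> 'rV[R]_p)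
    (b : 'rV[R]_p) :
  (forall d, (forall i, dotp (a i) d <= 0) -> dotp b d <= 0) ->
  exists2 c : 'I_r -> R,
    forall i, 0 <= c i & b = \sum_i c i *: a i.
Proof.
elim: r => [|r IHr] in a b *.
  move=> b_le0; exists (fun=> 0) => //; rewrite big_ord0.
  by apply: dotp_self_le0; apply: b_le0 => -[].
move=> b_le0.
have [b_le0'|] := pselect (forall d,
  (forall i, dotp (a (lift ord0 i)) d <= 0) -> dotp b d <= 0).
  have [c c_ge0 ->] := IHr _ _ b_le0'.
  exists (fun i => if unlift ord0 i is Some j then c j else 0) => [i|].
    by case: unliftP.
  rewrite big_ord_recl unlift_none scale0r add0r.
  by apply: eq_bigr => i _; rewrite liftK.
move=> /existsNP[y /not_implyP[y_le0 /negP]]; rewrite -ltNge => by_gt0.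
have ay_gt0 : 0 < dotp (a ord0) y.
  rewrite ltNge; apply/negP => ay_le0; move: by_gt0; rewrite ltNge b_le0// => i.
  by case: (unliftP ord0 i) => [j|] ->.
have [x [a0x bx_ge0 ax_le0]] : exists x, [/\ dotp (a ord0) x = 1,
    0 <= dotp b x & forall i, dotp (a (lift ord0 i)) x <= 0].
  exists ((dotp (a ord0) y)^-1 *: y); split=> [||i]; rewrite dotpZr.
  - by rewrite mulVf ?gt_eqF.
  - by rewrite mulr_ge0// ?invr_ge0 ltW.
  - by rewrite mulr_ge0_le0// invr_ge0 ltW.
(* [proj] is the adjoint of the projection along [x]. *)
pose proj u := u - dotp u x *: a ord0.
have projE u d : dotp (proj u) d = dotp u (d - dotp (a ord0) d *: x).
  by rewrite /proj dotpBl dotpZl dotpBr dotpZr mulrC.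
have [|c c_ge0 bE] := IHr (fun i => proj (a (lift ord0 i))) (proj b).
  move=> d d_le0; rewrite projE; apply: b_le0 => i.
  case: (unliftP ord0 i) => [j|] ->; first by rewrite -projE; exact: d_le0.
  by rewrite dotpBr dotpZr a0x mulr1 subrr.
pose c0 := dotp b x - \sum_i c i * dotp (a (lift ord0 i)) x.
exists (fun i => if unlift ord0 i is Some j then c j else c0) => [i|].
  case: unliftP => // _; rewrite subr_ge0 (le_trans _ bx_ge0)// sumr_le0// => j _.
  by rewrite mulr_ge0_le0.
rewrite big_ord_recl unlift_none -[LHS](subrK (dotp b x *: a ord0)).
rewrite -/(proj b) bE.
have -> : \sum_i c i *: proj (a (lift ord0 i)) =
    \sum_i c i *: a (lift ord0 i)
    - (\sum_i c i * dotp (a (lift ord0 i)) x) *: a ord0.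
  rewrite scaler_suml -sumrB; apply: eq_bigr => i _.
  by rewrite scalerBr scalerA.
under [in RHS]eq_bigr do rewrite liftK.
by rewrite /c0 scalerBl [RHS]addrC addrA [RHS]addrAC.
Qed.

(** * Tangent hyperplanes of convex functions *)

Lemma derive_dotp_gradient (R : realType) (p : nat) (h : 'rV[R]_p -> R)
    (z d : 'rV[R]_p) :
  differentiable h z -> 'D_d h z = dotp (gradient h z) d.
Proof.
move=> dh; rewrite deriveE// {1}(row_sum_delta d) linear_sum.
by apply: eq_bigr => i _; rewrite linearZ /= mxE deriveE// mulrC.
Qed.

(** Convexity bounds the difference quotient towards [w] by [h w - h z] at
    every step in the interval from 0 to 1, and the bound survives the
    limit. *)
Lemma convex_tangent_le {R : realType} {p : nat} {h : 'rV[R]_p -> R}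
    {z : 'rV[R]_p} (w : 'rV[R]_p) :
  convex_on_space h -> differentiable h z ->
  h z + dotp (gradient h z) (w - z) <= h w.
Proof.
move=> h_cvx dh; rewrite -lerBrDl -derive_dotp_gradient//.
have /cvg_dnbhs_at_right dq : derivable h z (w - z) by exact: diff_derivable.
apply: (cvgr_to_le dq).
near=> t.
have t_gt0 : 0 < t by near: t; exact: nbhs_right_gt.
have t_le1 : t <= 1 by near: t; exact: nbhs_right_ltW.
rewrite /= -[_ *: _]/(_ * _) mulrC ler_pdivrMr//.
have := h_cvx (Itv01 (ltW t_gt0) t_le1) w z (mem_set I) (mem_set I).
rewrite convRE /= /conv /= /unstable.onem.
have -> : t *: w + (1 - t) *: z = t *: (w - z) + z.
  by rewrite scalerBr scalerBl scale1r addrA addrAC.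
move=> hs; lra.
Unshelve. all: by end_near. Qed.

(** * From the linearized problem to the original ones *)

Section LinearizedProblem.
Context {R : realType} {n m r : nat}.
Context {f : 'rV[R]_n -> R} {g : 'rV[R]_(n + m) -> R}.
Context {gs : 'I_r -> 'rV[R]_(n + m) -> R}.
Hypothesis f_CN : CN_form f g gs.

Lemma feasible_direction z w :
  (forall i, differentiable (gs i) z) -> Xg gs z -> Xg gs w -> T gs z (w - z).
Proof.
case: f_CN => _ _ _ gs_cvx _ dgs z0 w0 i.
by have := convex_tangent_le w (gs_cvx i) (dgs i); rewrite z0 w0 add0r.
Qed.

Lemma linearized_ge0_CNP_optimal z :
  differentiable g z -> (forall i, differentiable (gs i) z) -> Xg gs z ->
  (forall d, T gs z d -> 0 <= dotp (gradient g z) d) ->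
  CNP_optimal g gs z.
Proof.
case: f_CN => _ _ g_cvx _ _ dg dgs z0 g_ge0; split=> // w w0.
apply: le_trans (convex_tangent_le w g_cvx dg).
by rewrite lerDl g_ge0//; exact: feasible_direction.
Qed.

Lemma CNP_optimal_CNO_optimal x y :
  f x = g (row_mx x y) -> CNP_optimal g gs (row_mx x y) -> CNO_optimal f x.
Proof.
case: f_CN => _ _ _ _ f_min fx [_ z_min]; split=> // x' _.
by have [y' [-> [y'0 _]]] := f_min x'; rewrite fx z_min.
Qed.

End LinearizedProblem.

Lemma KKT_linearized_ge0 {R : realType} {n m r : nat}
    {g : 'rV[R]_(n + m) -> R} {gs : 'I_r -> 'rV[R]_(n + m) -> R}
    {z ds d : 'rV[R]_(n + m)} {a : 'I_r -> R} :
  (forall i, 0 <= a i) -> KKT g gs z ds a -> T gs z d ->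
  0 <= dotp (gradient g z) d.
Proof.
move=> a_ge0 [/eqP + _] dT; rewrite addr_eq0 => /eqP ->.
rewrite dotpNl oppr_ge0 dotp_suml sumr_le0// => i _.
by rewrite dotpZl mulr_ge0_le0// dT.
Qed.

Lemma LCNP_optimal_KKT (R : realType) (n m r : nat)
    (g : 'rV[R]_(n + m) -> R) (gs : 'I_r -> 'rV[R]_(n + m) -> R)
    (z ds : 'rV[R]_(n + m)) :
  LCNP_optimal g gs z ds -> 0 <= dotp (gradient g z) ds ->
  exists a : 'I_r -> R, (forall i, 0 <= a i) /\ KKT g gs z ds a.
Proof.
move=> [dsT ds_min] ds_ge0.
have [|a a_ge0 gE] :=
    @farkas _ _ _ (fun i => gradient (gs i) z) (- gradient g z).
  by move=> d dT; rewrite dotpNl oppr_le0 (le_trans ds_ge0) ?ds_min.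
exists a; split=> //; split; first by rewrite -gE subrr.
have ds0 : dotp (gradient g z) ds = 0.
  apply/eqP; rewrite eq_le ds_ge0 andbT -(dotp0r _ _ (gradient g z)).
  by apply: ds_min => i; rewrite dotp0r.
have term_ge0 i : true -> 0 <= - (a i * dotp (gradient (gs i) z) ds).
  by rewrite oppr_ge0 mulr_ge0_le0// dsT.
have sum0 : \sum_i - (a i * dotp (gradient (gs i) z) ds) = 0.
  rewrite sumrN; under eq_bigr do rewrite -dotpZl.
  by rewrite -dotp_suml -gE dotpNl ds0 !oppr0.
by move=> i; apply: oppr_inj; rewrite (psumr_eq0P term_ge0 sum0 (isT : xpredT i)) oppr0.
Qed.

Theorem corollary3p2 (R : realType) (n m r : nat)
    (f : 'rV[R]_n -> R) (g : 'rV[R]_(n + m) -> R)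
    (gs : 'I_r -> 'rV[R]_(n + m) -> R)
    (g_diff2 : twice_differentiable g)
    (gs_diff2 : forall i, twice_differentiable (gs i))
    (f_CN : CN_form f g gs)
    (xs : 'rV[R]_n) (ys : 'rV[R]_m)
    (xys_Xf : Xf f g gs (row_mx xs ys)) :
  let zs : 'rV[R]_(n + m) := row_mx xs ys in
  (forall ds : 'rV[R]_(n + m),
      LCNP_optimal g gs zs ds -> 0 <= dotp (gradient g zs) ds ->
      (CNP_optimal g gs zs /\ CNO_optimal f xs) /\
      ((exists d' : 'rV[R]_(n + m),
           forall i, dotp (gradient (gs i) zs) d' < 0) ->
       exists a : 'I_r -> R,
         (forall i, 0 <= a i) /\ KKT g gs zs ds a)) /\
  ((exists (ds : 'rV[R]_(n + m)) (a : 'I_r -> R),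
      [/\ T gs zs ds, forall i, 0 <= a i & KKT g gs zs ds a]) ->
   CNP_optimal g gs zs /\ CNO_optimal f xs).
Proof.
move=> zs; have [zs0 fE] := xys_Xf; rewrite row_mxKl in fE.
have optimal : (forall d, T gs zs d -> 0 <= dotp (gradient g zs) d) ->
    CNP_optimal g gs zs /\ CNO_optimal f xs.
  move=> g_ge0; have zs_opt : CNP_optimal g gs zs.
    apply: (linearized_ge0_CNP_optimal f_CN _) => //; first exact: g_diff2.1.
    by move=> i; exact: (gs_diff2 i).1.
  by split=> //; exact: (CNP_optimal_CNO_optimal f_CN _ _ fE).
split=> [ds ds_opt ds_ge0|[ds [a [_ a_ge0 kkt]]]].
  split; last by move=> _; exact: LCNP_optimal_KKT.
  by apply: optimal => d dT; exact: le_trans ds_ge0 (ds_opt.2 d dT).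
by apply: optimal => d; exact: KKT_linearized_ge0 a_ge0 kkt.
Qed.
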